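(* Let $\mathbb{K}$ be a commutative ring. Any two non-degenerately homotopic non-degenerate morphisms of quivers $f\sim g:Q\to Q'$ induce chain homotopic morphisms of chain complexes $$\Omega^{\mathsf{sc}}f\sim\Omega^{\mathsf{sc}}g:\Omega^{\mathsf{sc}}Q\to\Omega^{\mathsf{sc}}Q'.$$
   Context: Quivers. A quiver $Q$ consists of sets $Q_0,Q_1$ and maps $h,t:Q_1\to Q_0$, $s:Q_0\to Q_1$ with $hs=\mathrm{id}=ts$. Elements of $Q_1^{\mathsf D}=s(Q_0)$ are degenerate arrows (write $1_v=s(v)$), elements of $Q_1^{\mathsf N}=Q_1\setminus s(Q_0)$ are non-degenerate. $Q(u,v)=\{\alpha\in Q_1\mid t(\alpha)=u,h(\alpha)=v\}$. A morphism of quivers is a pair of maps $f_0:Q_0\to R_0$, $f_1:Q_1\to R_1$ commuting with $h,t,s$; it is non-degenerate if $f_1(Q_1^{\mathsf N})\subseteq R_1^{\mathsf N}$. Box product. $Q\square R$ is the quiver with $(Q\square R)_0=Q_0\times R_0$, $(Q\square R)_1=(Q_1\times R_1^{\mathsf D})\cup(Q_1^{\mathsf D}\times R_1)$ and componentwise structure maps. Let $\mathsf{q}^1$ be the quiver with vertices $0,1$ and one non-degenerate arrow $0\to1$. The inclusions of the vertices $0$ and $1$ give non-degenerate morphisms $i^0,i^1:Q\to Q\square\mathsf{q}^1$, $v\mapsto(v,0)$ and $v\mapsto (v,1)$. Non-degenerate morphisms $f,g:Q\to Q'$ are one-step non-degenerately homotopic if there is a non-degenerate morphism $H:Q\square\mathsf{q}^1\to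 Q'$ with $Hi^0=f$, $Hi^1=g$; they are non-degenerately homotopic if they are equivalent under the smallest equivalence relation on non-degenerate morphisms $Q\to Q'$ containing this relation. Marked categories. A marked category is $(\mathcal{C},M)$ with $\mathcal{C}$ a small category and $M$ a set of morphisms containing all identities. $\mathsf{N}\mathcal{C}$ is the normalized chain complex over $\mathbb{K}$ of the nerve of $\mathcal{C}$: $(\mathsf{N}\mathcal{C})_0$ is free on objects; $(\mathsf{N}\mathcal{C})_n$ is free on symbols $\langle\gamma_1,\dots,\gamma_n\rangle$ of composable non-identity morphisms ($\mathrm{codom}(\gamma_i)=\mathrm{dom}(\gamma_{i+1})$), a symbol with an identity entry being $0$; $\partial=\sum_{i=0}^n(-1)^i\tilde d_i$, where $\tilde d_0$ deletes $\gamma_1$, $\tilde d_n$ deletes $\gamma_n$, $\tilde d_i$ ($1\le i\le n-1$) replaces $\gamma_i,\gamma_{i+1}$ by $\gamma_{i+1}\gamma_i$, and for $n=1$ $\tilde d_0\langle\gamma\rangle=\mathrm{codom}(\gamma)$, $\tilde d_1\langle\gamma\rangle=\mathrm{dom}(\gamma)$. $(\mathsf{N}M)_0=(\mathsf{N}\mathcal{C})_0$ and $(\mathsf{N}M)_n$ is spanned by the symbols with all $\gamma_i\in M$. $\Omega(\mathcal{C},M)$ is the subcomplex of $\mathsf{N}\mathcal{C}$ with $\Omega_n(\mathcal{C},M)=(\mathsf{N}M)_n\cap\partial^{-1}((\mathsf{N}M)_{n-1})$. Square-commutative complex. $\mathcal{Z}(Q)$ is the category with objects $Q_0$ and $\mathcal{Z}(Q)(v,u)=Q(v,u)\sqcup\{z_{v,u}\}$,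 $z_{v,u}$ a new formal arrow; the arrows $1_v$ are the identities and the composite of any two non-identity morphisms $v\to v'\to v''$ is $z_{v,v''}$. Then $\Omega^{\mathsf{sc}}Q=\Omega(\mathcal{Z}(Q),Q_1)$. A non-degenerate morphism $f$ induces a functor $\mathcal{Z}(Q)\to\mathcal{Z}(Q')$ ($\alpha\mapsto f(\alpha)$, $z_{v,u}\mapsto z_{f(v),f(u)}$), hence a chain map $\Omega^{\mathsf{sc}}f$. *)

(* Defs.v *)
From HB Require Import structures.
From Stdlib Require Import Relations.
From mathcomp Require Import all_boot all_algebra.
From mathcomp Require Import finmap.
From mathcomp Require Import monalg.
From mathcomp Require Import boolp.

Set Implicit Arguments.
Unset Strict Implicit.
Unset Printing Implicit Defensive.

Import GRing.Theory.

Local Open Scope ring_scope.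

Record quiver := Quiver {
  vert : choiceType;
  arr : choiceType;
  hd : arr -> vert;
  tl : arr -> vert;
  dgn : vert -> arr;
  dgnKh : cancel dgn hd;
  dgnKt : cancel dgn tl }.

Definition degenerate (Q : quiver) (a : arr Q) : bool := a == dgn (hd a).

Lemma degenerateP (Q : quiver) (a : arr Q) :
  reflect (exists v, a = dgn v) (degenerate a).
Proof.
apply: (iffP eqP) => [->|[v ->]]; first by exists (hd a).
by rewrite dgnKh.
Qed.

Lemma degenerate_dgn (Q : quiver) (v : vert Q) : degenerate (dgn v).
Proof. by rewrite /degenerate dgnKh. Qed.

Record qhom (Q R : quiver) := QHom {
  hom0 : vert Q -> vert R;
  hom1 : arr Q -> arr R;
  hom_hd : forall a, hd (hom1 a) = hom0 (hd a);
  hom_tl : forall a, tl (hom1 a) = hom0 (tl a);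
  hom_dgn : forall v, hom1 (dgn v) = dgn (hom0 v) }.

Definition nondegenerate (Q R : quiver) (f : qhom Q R) :=
  forall a, ~~ degenerate a -> ~~ degenerate (hom1 f a).

Record ndhom (Q R : quiver) := NDHom {
  ndhom_hom :> qhom Q R;
  ndhomP : nondegenerate ndhom_hom }.

Lemma ndhom_eq (Q R : quiver) (f g : ndhom Q R) :
  hom0 f =1 hom0 g -> hom1 f =1 hom1 g -> f = g.
Proof.
case: f g => [[f0 f1 fh ft fd] fn] [[g0 g1 gh gt gd] gn] /= /funext e0 /funext e1.
subst g0 g1.
rewrite (Prop_irrelevance gh fh) (Prop_irrelevance gt ft).
move: fn gn; rewrite (Prop_irrelevance gd fd) => fn gn.
by rewrite (Prop_irrelevance gn fn).
Qed.

Section Composition.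
Variables (Q R S : quiver) (g : ndhom R S) (f : ndhom Q R).

Fact ndcomp_hd a : hd (hom1 g (hom1 f a)) = hom0 g (hom0 f (hd a)).
Proof. by rewrite !hom_hd. Qed.
Fact ndcomp_tl a : tl (hom1 g (hom1 f a)) = hom0 g (hom0 f (tl a)).
Proof. by rewrite !hom_tl. Qed.
Fact ndcomp_dgn v : hom1 g (hom1 f (dgn v)) = dgn (hom0 g (hom0 f v)).
Proof. by rewrite !hom_dgn. Qed.
Fact ndcomp_nd : nondegenerate (QHom ndcomp_hd ndcomp_tl ndcomp_dgn).
Proof. by move=> a na; do 2!apply: ndhomP. Qed.

Definition ndcomp : ndhom Q S := NDHom ndcomp_nd.

End Composition.

Section Box.
Variables Q R : quiver.

Definition box_arr : choiceType :=
  {p : arr Q * arr R | degenerate p.2 || degenerate p.1}.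

Definition box_hd (p : box_arr) : vert Q * vert R := (hd (\val p).1, hd (\val p).2).
Definition box_tl (p : box_arr) : vert Q * vert R := (tl (\val p).1, tl (\val p).2).

Fact box_dgn_subproof (v : vert Q * vert R) :
  degenerate (dgn v.1, dgn v.2).2 || degenerate (dgn v.1, dgn v.2).1.
Proof. by rewrite degenerate_dgn. Qed.

Definition box_dgn (v : vert Q * vert R) : box_arr :=
  exist _ (dgn v.1, dgn v.2) (box_dgn_subproof v).

Fact box_dgnKh : cancel box_dgn box_hd.
Proof. by case=> u v; rewrite /box_hd /= !dgnKh. Qed.
Fact box_dgnKt : cancel box_dgn box_tl.
Proof. by case=> u v; rewrite /box_tl /= !dgnKt. Qed.

Definition box : quiver := Quiver box_dgnKh box_dgnKt.

End Box.

(* Vertices 0 and 1 are [false] and [true]; the arrow [Some b] is the degenerate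
   arrow at [b], and [None] is the arrow from 0 to 1. *)
Definition q1_hd (a : option bool) := odflt true a.
Definition q1_tl (a : option bool) := odflt false a.

Fact q1_dgnKh : cancel some q1_hd. Proof. by []. Qed.
Fact q1_dgnKt : cancel some q1_tl. Proof. by []. Qed.

Definition q1 : quiver := Quiver q1_dgnKh q1_dgnKt.

Section EndInclusion.
Variables (Q : quiver) (b : vert q1).

Fact inc_subproof (a : arr Q) :
  degenerate (a, dgn b).2 || degenerate (a, dgn b).1.
Proof. by rewrite degenerate_dgn. Qed.

Definition inc0 (v : vert Q) : vert (box Q q1) := (v, b).
Definition inc1 (a : arr Q) : arr (box Q q1) :=
  exist _ (a, dgn b) (inc_subproof a).

Fact inc_hd a : hd (inc1 a) = inc0 (hd a). Proof. by []. Qed.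
Fact inc_tl a : tl (inc1 a) = inc0 (tl a). Proof. by []. Qed.
Fact inc_dgn v : inc1 (dgn v) = dgn (inc0 v). Proof. exact: val_inj. Qed.

Fact inc_nd : nondegenerate (QHom inc_hd inc_tl inc_dgn).
Proof.
move=> a; apply: contra => /eqP/(congr1 \val) /= [ea].
by rewrite /degenerate -ea.
Qed.

Definition inc : ndhom Q (box Q q1) := NDHom inc_nd.

End EndInclusion.

Definition one_step_ndhomotopic (Q R : quiver) (f g : ndhom Q R) : Prop :=
  exists H : ndhom (box Q q1) R,
    ndcomp H (inc Q false) = f /\ ndcomp H (inc Q true) = g.

Definition ndhomotopic (Q R : quiver) : relation (ndhom Q R) :=
  clos_refl_sym_trans (ndhom Q R) (@one_step_ndhomotopic Q R).

Record complex (K : comPzRingType) := Complex {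
  chain :> nat -> lmodType K;
  diff : forall n, {linear chain n.+1 -> chain n};
  diff_diff : forall n x, diff n (diff n.+1 x) = 0 }.

Record chain_map (K : comPzRingType) (C D : complex K) := ChainMap {
  cmap :> forall n, {linear C n -> D n};
  cmap_diff : forall n x, cmap n (diff C n x) = diff D n (cmap n.+1 x) }.

Definition chain_homotopic (K : comPzRingType) (C D : complex K)
    (f g : chain_map C D) : Prop :=
  exists h : forall n, {linear C n -> D n.+1},
    (forall x, g 0 x - f 0 x = diff D 0 (h 0 x)) /\
    (forall n x, g n.+1 x - f n.+1 x =
       diff D n.+1 (h n.+1 x) + h n (diff C n x)).

(* [{malg K[T]}] is a module in the library only over a nontrivial ring. *)
Definition freemod (K : comPzRingType) (T : choiceType) := {malg K[T]}.
HB.instance Definition _ (K : comPzRingType) (T : choiceType) :=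
  GRing.Zmodule.on (freemod K T).

Section FreeModule.
Variables (K : comPzRingType) (T : choiceType).
Implicit Types (c : K) (x y : freemod K T).

Definition fscale c x : freemod K T := [malg t in msupp x => c * x@_t].

Fact fscaleE c x t : (fscale c x)@_t = c * x@_t.
Proof.
rewrite /mcoeff /= fsfunE; case: ifP => //= /negbT xt.
by rewrite -/(mcoeff t x) (mcoeff_outdom xt) mulr0.
Qed.

Fact fscaleA a b x : fscale a (fscale b x) = fscale (a * b) x.
Proof. by apply/malgP => t; rewrite !fscaleE mulrA. Qed.
Fact fscale1 : left_id 1 fscale.
Proof. by move=> x; apply/malgP => t; rewrite fscaleE mul1r. Qed.
Fact fscaleDr : right_distributive fscale +%R.
Proof. by move=> c x y; apply/malgP => t; rewrite fscaleE !mcoeffD !fscaleE mulrDr. Qed.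
Fact fscaleDl x : {morph fscale^~ x : a b / a + b}.
Proof. by move=> a b; apply/malgP => t; rewrite mcoeffD !fscaleE mulrDl. Qed.

HB.instance Definition _ := GRing.Zmodule_isLmodule.Build K (freemod K T)
  fscaleA fscale1 fscaleDr fscaleDl.

Lemma fcoeffZ c x t : (c *: x)@_t = c * x@_t. Proof. exact: fscaleE. Qed.

Definition fbasis (t : T) : freemod K T := << t >>.

Lemma fbasis_sum x : x = \sum_(t <- msupp x) x@_t *: fbasis t.
Proof.
rewrite [LHS]monalgE; apply: eq_bigr => t _; apply/malgP => u.
by rewrite fcoeffZ !mcoeffU mulrnAr mulr1.
Qed.

Lemma fbasis_ext (V : lmodType K) (f g : {linear freemod K T -> V}) :
  (forall t, f (fbasis t) = g (fbasis t)) -> f =1 g.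
Proof.
move=> fg x; rewrite (fbasis_sum x) !linear_sum; apply: eq_bigr => t _.
by rewrite !linearZ /= fg.
Qed.

Section Lift.
Variables (V : lmodType K) (f : T -> V).

Definition flift x : V := \sum_(t <- msupp x) x@_t *: f t.

Lemma flift_wider (d : {fset T}) x :
  (msupp x `<=` d)%fset -> flift x = \sum_(t <- d) x@_t *: f t.
Proof.
move=> le; rewrite /flift; apply: big_fset_incl => //= t _ xt.
by rewrite (mcoeff_outdom xt) scale0r.
Qed.

Fact flift_linear : linear flift.
Proof.
move=> c x y.
pose d := (msupp x `|` msupp y `|` msupp (c *: x + y))%fset.
rewrite !(@flift_wider d) /d; first last.
- by rewrite fsubsetUr.
- by apply: fsubset_trans (fsubsetUl _ _); rewrite fsubsetUl.
- by apply: fsubset_trans (fsubsetUl _ _); rewrite fsubsetUr.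
rewrite scaler_sumr -big_split /=; apply: eq_bigr => t _.
by rewrite mcoeffD fcoeffZ scalerDl scalerA.
Qed.

HB.instance Definition _ := GRing.isLinear.Build K (freemod K T) V _ flift flift_linear.

Lemma flift_basis t : flift (fbasis t) = f t.
Proof.
rewrite (@flift_wider [fset t]%fset) ?msuppU_le //.
by rewrite big_seq_fset1 /fbasis mcoeffUU scale1r.
Qed.

End Lift.

End FreeModule.

(* Small categories with a single set of morphisms; [cmp g f] is the composite
   g o f, with arbitrary value when [cod f != dom g]. *)
Record category := Category {
  ob : choiceType;
  mor : choiceType;
  dom : mor -> ob;
  cod : mor -> ob;
  idm : ob -> mor;
  cmp : mor -> mor -> mor;
  dom_idm : cancel idm dom;
  cod_idm : cancel idm cod;
  dom_cmp : forall g f, cod f = dom g -> dom (cmp g f) = dom f;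
  cod_cmp : forall g f, cod f = dom g -> cod (cmp g f) = cod g;
  cmp1m : forall f, cmp (idm (cod f)) f = f;
  cmpm1 : forall f, cmp f (idm (dom f)) = f;
  cmpA : forall h g f, cod f = dom g -> cod g = dom h ->
    cmp h (cmp g f) = cmp (cmp h g) f }.

Definition is_id (C : category) (f : mor C) : bool := f == idm (dom f).

Record functor (C D : category) := Functor {
  fob : ob C -> ob D;
  fmor : mor C -> mor D;
  dom_fmor : forall f, dom (fmor f) = fob (dom f);
  cod_fmor : forall f, cod (fmor f) = fob (cod f);
  fmor_idm : forall x, fmor (idm x) = idm (fob x);
  fmor_cmp : forall g f, cod f = dom g -> fmor (cmp g f) = cmp (fmor g) (fmor f) }.

Record marked_category := MarkedCategory {
  mcat :> category;
  marked : pred (mor mcat);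
  marked_idm : forall x, marked (idm x) }.

Record marked_functor (C D : marked_category) := MarkedFunctor {
  mfunctor :> functor C D;
  mfunctor_marked : forall f, marked f -> marked (fmor mfunctor f) }.

Section NerveDefs.
Variables (K : comPzRingType) (C : category).
Implicit Types (x : ob C) (s : seq (mor C)) (p : ob C * seq (mor C)).

Fixpoint composable x s : bool :=
  if s is f :: s' then (dom f == x) && composable (cod f) s' else true.

(* The pair [(x, [:: f1; ...; fn])] stands for the symbol <f1, ..., fn>. Its
   starting object [x] is redundant unless [n = 0], where the symbol is [x]. *)
Definition is_simplex n p : bool :=
  [&& size p.2 == n, composable p.1 p.2 & all (predC (@is_id C)) p.2].

Definition simplex n : choiceType := {p : ob C * seq (mor C) | is_simplex n p}.

Definition nchain n : lmodType K := freemod K (simplex n).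

(* Total on pairs: in particular a symbol with an identity entry is 0. *)
Definition symb n p : nchain n :=
  if @insub _ (is_simplex n) (simplex n) p is Some t then fbasis K t else 0.

(* Replaces the arrows f, g at positions i, i+1 (from 0) by g o f, or deletes the
   last arrow if it is the one at position i. *)
Fixpoint merge_at i s : seq (mor C) :=
  match i, s with
  | 0, f :: g :: s' => cmp g f :: s'
  | i'.+1, f :: s' => f :: merge_at i' s'
  | _, _ => [::]
  end.

Definition face i p : ob C * seq (mor C) :=
  match i, p with
  | 0, (x, f :: s) => (cod f, s)
  | 0, (x, [::]) => (x, [::])
  | i'.+1, (x, s) => (x, merge_at i' s)
  end.

Definition alt_faces n p : nchain n :=
  \sum_(i < n.+2) (-1) ^+ i *: symb n (face i p).

Definition bd n : nchain n.+1 -> nchain n :=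
  flift (fun t : simplex n.+1 => alt_faces n (\val t)).

HB.instance Definition _ n := GRing.Linear.on (@bd n).

End NerveDefs.

Section NerveTheory.
Variables (K : comPzRingType) (C : category).
Implicit Types (x : ob C) (s : seq (mor C)) (p : ob C * seq (mor C)).

Lemma symb_val n (t : simplex C n) : symb K n (\val t) = fbasis K t.
Proof. by rewrite /symb valK. Qed.

Lemma symb_id n p : has (@is_id C) p.2 -> symb K n p = 0.
Proof.
move=> hp; rewrite /symb insubF //; apply/negbTE/negP => /and3P[_ _].
by rewrite all_predC hp.
Qed.

Lemma symb_simplex n p : size p.2 = n -> composable p.1 p.2 ->
  ~~ has (@is_id C) p.2 -> exists t : simplex C n, \val t = p.
Proof.
move=> sp cp np; have hp : is_simplex n p.
  by rewrite /is_simplex sp eqxx cp all_predC.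
by exists (Sub p hp); rewrite SubK.
Qed.

Lemma size_merge_at i s : (i < size s)%N -> size (merge_at i s) = (size s).-1.
Proof.
elim: i s => [|i IH] [|f s] //=; first by case: s.
by rewrite ltnS => lt_is; rewrite IH //; case: s lt_is.
Qed.

Lemma size_face i p : (i <= size p.2)%N -> size (face i p).2 = (size p.2).-1.
Proof. by case: i p => [|i] [x s] => [_|]; [case: s | exact: size_merge_at]. Qed.

Lemma composable_merge_at i x s : composable x s -> composable x (merge_at i s).
Proof.
elim: i x s => [|i IH] x [|f s] //=.
  case: s => [|g s] //= /and3P[/eqP fx /eqP gf cs].
  by rewrite dom_cmp // cod_cmp // fx eqxx.
by case/andP=> -> /IH.
Qed.

Lemma composable_face i p :
  composable p.1 p.2 -> composable (face i p).1 (face i p).2.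
Proof.
case: i p => [|i] [x s]; last exact: composable_merge_at.
by case: s => [|f s] //= /andP[].
Qed.

Lemma merge_at_merge_at i j x s : composable x s -> (j < i)%N -> (i < size s)%N ->
  merge_at j (merge_at i s) = merge_at i.-1 (merge_at j s).
Proof.
elim: j i x s => [|j IH] [|i] x [|f s] //=.
  case: i => [|i]; case: s => [|g s] //=.
  case: s => [|h s] //= /and4P[_ /eqP gf /eqP hg _] _ _.
  by rewrite cmpA.
case/andP=> _ cs; rewrite !ltnS => lt_ji lt_is; rewrite (IH i (cod f)) //.
by case: i lt_ji {lt_is}.
Qed.

Lemma face_face i j p : composable p.1 p.2 -> (j < i)%N -> (i <= size p.2)%N ->
  (1 < size p.2)%N -> face j (face i p) = face i.-1 (face j p).
Proof.
case: p => x [|f s] //=; case: i => [|i] //= cs; rewrite ltnS; case: j => [|j] /=.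
  case: i => [|i] //; case: s cs => [|g s] //= /and3P[_ /eqP gf _] _ _ _.
  by rewrite cod_cmp.
move=> lt_ji lt_is _; case: i lt_ji lt_is => // i lt_ji lt_is /=.
by congr pair; exact: (@merge_at_merge_at i.+1 j x (f :: s)).
Qed.

Lemma face_before_id i x s1 y s2 : (i < size s1)%N ->
  has (@is_id C) (face i (x, s1 ++ idm y :: s2)).2.
Proof.
have hid s : has (@is_id C) (s ++ idm y :: s2).
  by rewrite has_cat /= {2}/is_id dom_idm eqxx orbT.
case: i => [|i]; case: s1 => [|f s1] //= lt_is.
elim: i f s1 lt_is => [|i IH] f [|g s1] //= lt_is; last by rewrite IH ?orbT.
by rewrite hid orbT.
Qed.

Lemma face_after_id i x s1 y s2 :
  (size s1 < i)%N -> (i <= size s1 + size s2)%N ->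
  has (@is_id C) (face i.+1 (x, s1 ++ idm y :: s2)).2.
Proof.
move=> /=; elim: s1 i => [|f s1 IH] [|i] //=.
  by rewrite /is_id dom_idm eqxx.
by rewrite addSn !ltnS => l1 l2; rewrite IH ?orbT.
Qed.

Lemma face_id x s1 y s2 : composable x (s1 ++ idm y :: s2) ->
  face (size s1) (x, s1 ++ idm y :: s2) = face (size s1).+1 (x, s1 ++ idm y :: s2).
Proof.
case: s1 => [|f s1] /=.
  rewrite dom_idm cod_idm => /andP[/eqP -> cs]; congr pair.
  by case: s2 cs => [|g s2] //= /andP[/eqP <- _]; rewrite cmpm1.
case/andP=> _ cs; congr pair.
elim: s1 f cs => [|g s1 IH] f /=.
  rewrite dom_idm cod_idm => /andP[/eqP yf cs]; rewrite yf cmp1m; congr cons.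
  by case: s2 cs => [|g s2] //= /andP[/eqP]; rewrite yf => <- _; rewrite cmpm1.
by case/andP=> _ cs; rewrite -IH.
Qed.

#[local] Arguments face : simpl never.

Lemma alt_faces_id n p : size p.2 = n.+1 -> composable p.1 p.2 ->
  has (@is_id C) p.2 -> alt_faces K n p = 0.
Proof.
case: p => x s /= sz cs /hasP[e es /eqP ee]; rewrite {}ee in es.
move: (dom e) es sz cs => {e} y /splitPr[s1 s2]; rewrite size_cat /= => sz cs.
have lt1 : (size s1 < n.+2)%N by rewrite -sz ltnS leq_addr.
have lt2 : ((size s1).+1 < n.+2)%N by rewrite -sz ltnS addnS ltnS leq_addr.
rewrite /alt_faces (bigD1 (Ordinal lt1)) //= (bigD1 (Ordinal lt2)) /=; last first.
  by rewrite -val_eqE /= eqn_leq ltnn.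
rewrite -face_id // exprS mulN1r scaleNr addrA addrN add0r.
apply: big1 => -[[|i] lt_in] /andP[]; rewrite -!val_eqE /= => n1 n2.
  by rewrite symb_id ?scaler0 // face_before_id // lt0n eq_sym.
have [lt_is|] := ltnP i.+1 (size s1); first by rewrite symb_id ?scaler0 ?face_before_id.
rewrite leq_eqVlt eq_sym (negbTE n1) /= ltnS leq_eqVlt eq_sym.
rewrite eqSS in n2; rewrite (negbTE n2) /= => lt_si.
rewrite symb_id ?scaler0 // face_after_id //.
by move: lt_in; rewrite -sz addnS !ltnS.
Qed.

Lemma bd_symb n p : size p.2 = n.+1 -> composable p.1 p.2 ->
  bd (symb K n.+1 p) = alt_faces K n p.
Proof.
move=> sp cp; have [hid|nid] := boolP (has (@is_id C) p.2).
  by rewrite symb_id // linear0 alt_faces_id.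
have [t <-] := symb_simplex sp cp nid.
by rewrite symb_val /bd flift_basis.
Qed.

Lemma alt_sum_pairs (V : lmodType K) (N : nat) (a : nat -> nat -> V) :
  (forall i j, (j < i)%N -> (i <= N)%N -> a i j = a j i.-1) ->
  \sum_(i < N.+1) \sum_(j < N) ((-1) ^+ i * (-1) ^+ j) *: a i j = 0.
Proof.
move=> aE; pose F (i j : nat) : V := ((-1) ^+ i * (-1) ^+ j) *: a i j.
transitivity (\sum_(i < N.+1) \sum_(j < N | (j < i)%N) F i j
  + \sum_(i < N.+1) \sum_(j < N | ~~ (j < i)%N) F i j).
  rewrite -big_split; apply: eq_bigr => i _ /=.
  by rewrite (bigID (fun j : 'I_N => (j < i)%N)).
rewrite big_ord_recl /= big_pred0 // add0r [X in _ + X]big_ord_recr /=.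
rewrite [X in _ + (_ + X)]big_pred0 ?addr0; last by move=> j; rewrite ltn_ord.
rewrite [X in _ + X](exchange_big_dep xpredT) //= -big_split big1 // => i _ /=.
rewrite (eq_bigl (fun j : 'I_N => ~~ (i < j)%N)); last first.
  by move=> j; rewrite /= -leqNgt.
rewrite -big_split big1 // => j; rewrite -leqNgt => le_ji /=.
rewrite /F /bump leq0n add1n aE ?ltnS //= exprS mulN1r mulNr scaleNr.
by rewrite [X in - (X *: _)]mulrC addNr.
Qed.

Lemma bd_bd n (x : nchain K C n.+2) : bd (bd x) = 0.
Proof.
apply: (@fbasis_ext _ _ _ (@bd K C n \o @bd K C n.+1) \0) => t {x} /=.
rewrite [X in bd X]flift_basis; case/and3P: (valP t) => /eqP sp cp _.
rewrite /alt_faces linear_sum /=.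
transitivity (\sum_(i < n.+3) \sum_(j < n.+2) ((-1) ^+ i * (-1) ^+ j) *:
  symb K n (face j (face i (\val t)))).
  apply: eq_bigr => i _; rewrite linearZ /= bd_symb ?composable_face //.
    by rewrite /alt_faces scaler_sumr; apply: eq_bigr => j _; rewrite scalerA.
  by rewrite size_face sp // -ltnS.
apply: (@alt_sum_pairs _ n.+2 (fun i j => symb K n (face j (face i (\val t))))).
by move=> i j lt_ji le_i; rewrite face_face ?sp.
Qed.

End NerveTheory.

Section Omega.
Variables (K : comPzRingType) (C : marked_category).

Definition marked_simplex n (t : simplex C n) : bool := all (@marked C) (\val t).2.

Definition marked_chains n : {pred nchain K C n} :=
  fun x => all (@marked_simplex n) (msupp x).

Lemma marked_chainsP n (x : nchain K C n) :
  reflect (forall t, ~~ marked_simplex t -> x@_t = 0) (x \in @marked_chains n).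
Proof.
apply: (iffP allP) => [h t|h t]; last by rewrite -mcoeff_neq0; apply: contraNT => /h ->.
by apply: contraNeq; rewrite mcoeff_neq0 => /h.
Qed.

(* (NM)_n is the span of the marked symbols. *)
Lemma marked_chains_span n (x : nchain K C n) :
  (x \in @marked_chains n) <->
  exists2 r : seq (simplex C n), all (@marked_simplex n) r &
    exists c : simplex C n -> K, x = \sum_(t <- r) c t *: fbasis K t.
Proof.
split=> [mx|[r /allP mr [c ->]]].
  by exists (msupp x) => //; exists (fun t => x@_t); exact: fbasis_sum.
apply/marked_chainsP => t nt; rewrite raddf_sum big_seq big1 //= => u /mr mu.
rewrite fcoeffZ mcoeffU; case: eqP => [eu|_]; last by rewrite mulr0.
by rewrite -eu mu in nt.
Qed.

Fact marked_chains_submod n : submod_closed (@marked_chains n).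
Proof.
split=> [|c x y /marked_chainsP hx /marked_chainsP hy]; apply/marked_chainsP => t nt.
  by rewrite mcoeff0.
by rewrite mcoeffD fcoeffZ hx // hy // mulr0 addr0.
Qed.

HB.instance Definition _ n :=
  GRing.isSubmodClosed.Build K (nchain K C n) (@marked_chains n)
    (@marked_chains_submod n).

Lemma symb_marked n p : all (@marked C) p.2 -> symb K n p \in @marked_chains n.
Proof.
move=> mp; rewrite /symb; case: insubP => [t _ et|_]; last exact: rpred0.
apply/marked_chainsP => u; rewrite mcoeffU; case: eqP => // <-.
by rewrite /marked_simplex et mp.
Qed.

Definition omega_pred n : {pred nchain K C n} :=
  match n with
  | 0 => fun x => x \in @marked_chains 0
  | n'.+1 => fun x => (x \in @marked_chains n'.+1) && (bd x \in @marked_chains n')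
  end.

Fact omega_submod n : submod_closed (@omega_pred n).
Proof.
case: n => [|n]; first exact: marked_chains_submod.
split=> [|c x y]; first by apply/andP; rewrite linear0 !rpred0.
case/andP=> mx mbx /andP[my mby]; apply/andP; rewrite linearP.
by split; apply: rpredD => //; apply: rpredZ.
Qed.

HB.instance Definition _ n :=
  GRing.isSubmodClosed.Build K (nchain K C n) (@omega_pred n) (@omega_submod n).

Record omega_chain n := OmegaChain {
  omega_val : nchain K C n;
  omega_valP : omega_val \in @omega_pred n }.

HB.instance Definition _ n := [isSub for @omega_val n].
HB.instance Definition _ n := [Choice of omega_chain n by <:].
HB.instance Definition _ n := [SubChoice_isSubLmodule of omega_chain n by <:].

Lemma omega_marked n (x : omega_chain n) : omega_val x \in @marked_chains n.
Proof. by case: n x => [|n] [x] //= /andP[]. Qed.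

Fact omega_bd_subproof n (x : omega_chain n.+1) : bd (omega_val x) \in @omega_pred n.
Proof.
case: n x => [|n] [x] /=; case/andP => _ mbx //.
by apply/andP; rewrite bd_bd rpred0.
Qed.

Definition omega_bd n (x : omega_chain n.+1) : omega_chain n :=
  OmegaChain (omega_bd_subproof x).

Fact omega_bd_linear n : linear (@omega_bd n).
Proof. by move=> c x y; apply: val_inj; rewrite /= linearP. Qed.

HB.instance Definition _ n :=
  GRing.isLinear.Build K (omega_chain n.+1) (omega_chain n) _ (@omega_bd n)
    (@omega_bd_linear n).

Fact omega_bd_bd n (x : omega_chain n.+2) : omega_bd (omega_bd x) = 0.
Proof. by apply: val_inj; rewrite /= bd_bd. Qed.

Definition omega : complex K :=
  @Complex K (fun n => omega_chain n : lmodType K)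
    (fun n => @omega_bd n : {linear _ -> _}) omega_bd_bd.

End Omega.

Section NerveMap.
Variables (K : comPzRingType) (C D : category) (F : functor C D).
Implicit Types (s : seq (mor C)) (p : ob C * seq (mor C)).

Definition fsymb p : ob D * seq (mor D) := (fob F p.1, map (fmor F) p.2).

Definition nerve_map n : nchain K C n -> nchain K D n :=
  flift (fun t : simplex C n => symb K n (fsymb (\val t))).

HB.instance Definition _ n := GRing.Linear.on (@nerve_map n).

Lemma fmor_is_id f : is_id f -> is_id (fmor F f).
Proof. by rewrite /is_id dom_fmor => /eqP {1}->; rewrite fmor_idm. Qed.

Lemma composable_fsymb p :
  composable p.1 p.2 -> composable (fsymb p).1 (fsymb p).2.
Proof.
case: p => x s /=; elim: s x => //= f s IH x /andP[/eqP <- /IH].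
by rewrite dom_fmor cod_fmor eqxx.
Qed.

Lemma map_merge_at i x s : composable x s ->
  map (fmor F) (merge_at i s) = merge_at i (map (fmor F) s).
Proof.
elim: i x s => [|i IH] x [|f s] //=.
  by case: s => [|g s] //= /and3P[_ /eqP gf _]; rewrite fmor_cmp.
by case/andP=> _ /IH ->.
Qed.

Lemma face_fsymb i p : composable p.1 p.2 -> face i (fsymb p) = fsymb (face i p).
Proof.
case: p => x s /= cs; case: i => [|i].
  by case: s cs => [|f s] //= _; rewrite /face /fsymb /= cod_fmor.
by rewrite /face /fsymb /= (map_merge_at i cs).
Qed.

Lemma nerve_map_symb n p : size p.2 = n -> composable p.1 p.2 ->
  nerve_map (symb K n p) = symb K n (fsymb p).
Proof.
move=> sp cp; have [hid|nid] := boolP (has (@is_id C) p.2).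
  rewrite symb_id // linear0 symb_id //= has_map.
  by apply: sub_has hid => f /=; apply: fmor_is_id.
have [t <-] := symb_simplex sp cp nid.
by rewrite symb_val [LHS]flift_basis.
Qed.

Lemma nerve_map_bd n (x : nchain K C n.+1) :
  nerve_map (bd x) = bd (nerve_map x).
Proof.
apply: (@fbasis_ext _ _ _ (@nerve_map n \o @bd K C n) (@bd K D n \o @nerve_map n.+1)).
move=> t {x} /=; case/and3P: (valP t) => /eqP sp cp _.
rewrite [X in nerve_map X]flift_basis [X in bd X]flift_basis.
rewrite bd_symb ?size_map //; last exact: composable_fsymb.
rewrite /alt_faces linear_sum; apply: eq_bigr => i _.
rewrite linearZ /= face_fsymb // nerve_map_symb ?composable_face //.
by rewrite size_face sp // -ltnS.
Qed.

End NerveMap.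

Section OmegaMap.
Variables (K : comPzRingType) (C D : marked_category) (F : marked_functor C D).

Lemma nerve_map_marked n x :
  x \in @marked_chains K C n -> nerve_map F x \in @marked_chains K D n.
Proof.
move/allP=> mx; rewrite /nerve_map /flift big_seq; apply: rpred_sum => t /mx mt.
apply: rpredZ; apply: symb_marked; rewrite /= all_map.
by apply: sub_all mt => f; exact: mfunctor_marked.
Qed.

Fact omega_map_subproof n (x : omega_chain K C n) :
  nerve_map F (omega_val x) \in @omega_pred K D n.
Proof.
case: n x => [|n] [x] /=; first exact: nerve_map_marked.
case/andP=> mx mbx; apply/andP; rewrite -nerve_map_bd.
by split; apply: nerve_map_marked.
Qed.

Definition omega_map_chain n (x : omega_chain K C n) : omega_chain K D n :=
  OmegaChain (omega_map_subproof x).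

Fact omega_map_linear n : linear (@omega_map_chain n).
Proof. by move=> c x y; apply: val_inj; rewrite /= linearP. Qed.

HB.instance Definition _ n :=
  GRing.isLinear.Build K (omega_chain K C n) (omega_chain K D n) _
    (@omega_map_chain n) (@omega_map_linear n).

Fact omega_map_bd n (x : omega_chain K C n.+1) :
  omega_map_chain (omega_bd x) = omega_bd (omega_map_chain x).
Proof. by apply: val_inj; rewrite /= nerve_map_bd. Qed.

Definition omega_map : chain_map (omega K C) (omega K D) :=
  @ChainMap K (omega K C) (omega K D)
    (fun n => @omega_map_chain n : {linear _ -> _}) omega_map_bd.

End OmegaMap.

Section SquareCategory.
Variable Q : quiver.

(* [inl a] is the arrow a of Q, and [inr (v, u)] is z_{v,u} : v -> u. *)
Definition sq_mor : choiceType := (arr Q + vert Q * vert Q)%type.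

Definition sq_dom (m : sq_mor) : vert Q :=
  match m with inl a => tl a | inr p => p.1 end.
Definition sq_cod (m : sq_mor) : vert Q :=
  match m with inl a => hd a | inr p => p.2 end.
Definition sq_idm (v : vert Q) : sq_mor := inl (dgn v).
Definition sq_is_id (m : sq_mor) : bool := m == sq_idm (sq_dom m).
Definition sq_cmp (g f : sq_mor) : sq_mor :=
  if sq_is_id f then g else if sq_is_id g then f else inr (sq_dom f, sq_cod g).

Fact sq_dom_idm : cancel sq_idm sq_dom. Proof. exact: dgnKt. Qed.
Fact sq_cod_idm : cancel sq_idm sq_cod. Proof. exact: dgnKh. Qed.

Fact sq_is_idm v : sq_is_id (sq_idm v).
Proof. by rewrite /sq_is_id sq_dom_idm. Qed.

Fact sq_id_cod m : sq_is_id m -> sq_cod m = sq_dom m.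
Proof. by move=> /eqP ->; rewrite sq_cod_idm sq_dom_idm. Qed.

Fact sq_dom_cmp g f : sq_cod f = sq_dom g -> sq_dom (sq_cmp g f) = sq_dom f.
Proof.
move=> fg; rewrite /sq_cmp; case: ifP => [idf|_]; first by rewrite -fg sq_id_cod.
by case: ifP.
Qed.

Fact sq_cod_cmp g f : sq_cod f = sq_dom g -> sq_cod (sq_cmp g f) = sq_cod g.
Proof.
move=> fg; rewrite /sq_cmp; case: ifP => // _; case: ifP => // idg.
by rewrite fg sq_id_cod.
Qed.

Fact sq_cmp1m f : sq_cmp (sq_idm (sq_cod f)) f = f.
Proof.
rewrite /sq_cmp sq_is_idm; case: ifP => // idf.
by rewrite sq_id_cod // -(eqP idf).
Qed.

Fact sq_cmpm1 f : sq_cmp f (sq_idm (sq_dom f)) = f.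
Proof. by rewrite /sq_cmp sq_is_idm. Qed.

Fact sq_cmpA h g f : sq_cod f = sq_dom g -> sq_cod g = sq_dom h ->
  sq_cmp h (sq_cmp g f) = sq_cmp (sq_cmp h g) f.
Proof.
move=> fg gh; rewrite /sq_cmp.
case idf: (sq_is_id f) => //; case idg: (sq_is_id g); first by rewrite idf.
by case idh: (sq_is_id h); rewrite //= idg.
Qed.

Definition sq_category : category :=
  Category sq_dom_idm sq_cod_idm sq_dom_cmp sq_cod_cmp sq_cmp1m sq_cmpm1 sq_cmpA.

Definition sq_marked (m : mor sq_category) : bool := if m is inl _ then true else false.

Fact sq_marked_idm (v : ob sq_category) : sq_marked (idm v). Proof. by []. Qed.

Definition sq_marked_category : marked_category := MarkedCategory sq_marked_idm.

End SquareCategory.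

Section SquareFunctor.
Variables (Q R : quiver) (f : ndhom Q R).

Definition sq_fob (v : ob (sq_category Q)) : ob (sq_category R) := hom0 f v.

Definition sq_fmor (m : mor (sq_category Q)) : mor (sq_category R) :=
  match m with
  | inl a => inl (hom1 f a)
  | inr p => inr (hom0 f p.1, hom0 f p.2)
  end.

Fact sq_dom_fmor m : dom (sq_fmor m) = sq_fob (dom m).
Proof. by case: m => [a|p] //=; rewrite hom_tl. Qed.
Fact sq_cod_fmor m : cod (sq_fmor m) = sq_fob (cod m).
Proof. by case: m => [a|p] //=; rewrite hom_hd. Qed.
Fact sq_fmor_idm v : sq_fmor (idm v) = idm (sq_fob v).
Proof. by rewrite /= /sq_idm hom_dgn. Qed.

Fact sq_is_id_degenerate (S : quiver) (a : arr S) :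
  sq_is_id (inl a) = degenerate a.
Proof.
rewrite /sq_is_id /degenerate; apply/eqP/eqP => [[->]|ea]; rewrite ?dgnKh //.
by rewrite ea /sq_idm /= dgnKt.
Qed.

Fact sq_is_id_fmor m : sq_is_id (sq_fmor m) = sq_is_id m.
Proof.
case: m => [a|p] //; rewrite !sq_is_id_degenerate.
apply/idP/idP => [|/degenerateP[v ->]]; first exact: contraTT (@ndhomP _ _ f a).
by rewrite hom_dgn degenerate_dgn.
Qed.

Fact sq_fmor_cmp (n m : mor (sq_category Q)) : cod m = dom n ->
  sq_fmor (cmp n m) = cmp (sq_fmor n) (sq_fmor m).
Proof.
move=> _; rewrite /= /sq_cmp !sq_is_id_fmor; do 2!case: ifP => // _.
congr (inr (_, _)); symmetry; [exact: sq_dom_fmor | exact: sq_cod_fmor].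
Qed.

Definition sq_functor : functor (sq_category Q) (sq_category R) :=
  Functor sq_dom_fmor sq_cod_fmor sq_fmor_idm sq_fmor_cmp.

Fact sq_functor_marked (m : mor (sq_marked_category Q)) :
  marked m -> @marked (sq_marked_category R) (fmor sq_functor m).
Proof. by case: m. Qed.

Definition sq_marked_functor :
    marked_functor (sq_marked_category Q) (sq_marked_category R) :=
  MarkedFunctor sq_functor_marked.

End SquareFunctor.

Definition omega_sc (K : comPzRingType) (Q : quiver) : complex K :=
  omega K (sq_marked_category Q).

Definition omega_sc_map (K : comPzRingType) (Q R : quiver) (f : ndhom Q R) :
    chain_map (omega_sc K Q) (omega_sc K R) :=
  omega_map K (sq_marked_functor f).

(* Main.v *)
(** A one-step homotopy [H] gives arrows [H(1_v, 0 -> 1) : f v -> g v] that are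
    non-degenerate. In the square-commutative category every composite of two
    non-identity morphisms is the formal arrow between their endpoints, so these
    arrows automatically form a natural transformation, with marked components.
    The prism operator of a natural transformation preserves marked chains, and
    the homotopy identity then shows that it preserves the subcomplex. *)
Require Import Defs.
From HB Require Import structures.
From mathcomp Require Import all_boot all_algebra.

Set Implicit Arguments.
Unset Strict Implicit.
Unset Printing Implicit Defensive.

Import GRing.Theory.

Local Open Scope ring_scope.

(** * Chain homotopy as an equivalence relation *)

Section ChainHomotopic.
Variables (K : comPzRingType) (C D : complex K).
Implicit Types f g : chain_map C D.

Lemma chain_homotopic_refl f : chain_homotopic f f.
Proof.
exists (fun n => \0 : {linear C n -> D n.+1}).
by split=> [|n] x; rewrite subrr !linear0 ?addr0.
Qed.

Lemma chain_homotopic_sym f g : chain_homotopic f g -> chain_homotopic g f.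
Proof.
case=> h [h0 hS]; exists (fun n => \- h n : {linear C n -> D n.+1}).
split=> [|n] x /=; first by rewrite linearN /= -h0 opprB.
by rewrite linearN /= -opprD -hS opprB.
Qed.

Lemma chain_homotopic_trans f g k :
  chain_homotopic f g -> chain_homotopic g k -> chain_homotopic f k.
Proof.
case=> h [h0 hS] [l [l0 lS]].
exists (fun n => h n \+ l n : {linear C n -> D n.+1}).
split=> [|n] x /=; first by rewrite linearD /= -h0 -l0 [RHS]addrC subrKA.
by rewrite linearD /= addrACA -hS -lS [RHS]addrC subrKA.
Qed.

End ChainHomotopic.

(** Sign bookkeeping for the prism identity, with [a i j] the [i]-th face of the [j]-th prism
    simplex and [b i j] the [j]-th prism of the [i]-th face. Faces interior to the prism cancel in
    neighbouring pairs, so the diagonal telescopes; the other faces cancel against [b]. *)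
Lemma alt_sum_prism (K : comPzRingType) (V : lmodType K) (N : nat) (a b : nat -> nat -> V) :
  (forall i j, (i <= j)%N -> (j < N)%N -> a i j.+1 = b i j) ->
  (forall i j, (j < i)%N -> (i <= N)%N -> a i.+1 j = b i j) ->
  (forall j, (j < N)%N -> a j.+1 j.+1 = a j.+1 j) ->
  \sum_(j < N.+1) \sum_(i < N.+2) ((-1) ^+ j * (-1) ^+ i) *: a i j
  + \sum_(i < N.+1) \sum_(j < N) ((-1) ^+ i * (-1) ^+ j) *: b i j
  = a 0%N 0%N - a N.+1 N.
Proof.
move=> aS bS dS.
(* Faces [j] and [j.+1] are split off; [bump j i] with [i != j] runs over the rest. *)
have split_row (j : 'I_N.+1) : \sum_(i < N.+2) ((-1) ^+ j * (-1) ^+ i) *: a i j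
    = (a j j - a j.+1 j)
      + \sum_(i < N.+1 | i != j) ((-1) ^+ j * (-1) ^+ bump j i) *: a (bump j i) j.
  rewrite (bigD1_ord (widen_ord (leqnSn _) j)) //= (bigD1 j) //= addrA.
  rewrite /bump leqnn add1n -expr2 sqrr_sign scale1r.
  by rewrite exprS mulN1r mulrN scaleNr -expr2 sqrr_sign scale1r.
rewrite (eq_bigr _ (fun j _ => split_row j)) big_split /= -addrA.
have -> : \sum_(j < N.+1) (a j j - a j.+1 j) = a 0%N 0%N - a N.+1 N.
  rewrite sumrB big_ord_recl big_ord_recr /=.
  rewrite (eq_bigr (fun j : 'I_N => a j.+1 j)) => [|j _]; last exact: dS.
  by rewrite opprD addrA addrK.
(* For fixed [i], writing each index other than [i] as [lift i j] matches the off-diagonal terms one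
   by one with the [b i j], with opposite signs. *)
rewrite (exchange_big_dep xpredT) //= -big_split big1 ?addr0 // => i _ /=.
rewrite (reindex_omap (lift i) (unlift i)) /=; last first.
  by move=> j; case: unliftP => [k ->|->] //; rewrite eqxx.
rewrite (eq_bigl xpredT) => [|j]; last by rewrite liftK eqxx neq_lift.
rewrite -big_split big1 // => j _ /=; rewrite /bump.
case: (leqP i j) => [le_ij|lt_ji]; rewrite ?add1n ?add0n.
  rewrite ltnNge le_ij add0n aS // exprS mulN1r mulNr scaleNr.
  by rewrite [X in X *: _]mulrC addNr.
rewrite ltnW // add1n bS -1?ltnS // exprS mulN1r mulrN scaleNr.
by rewrite [X in - (X *: _)]mulrC addNr.
Qed.

(** * Prism simplices of a natural transformation and their faces *)

Section Prism.
Variables (C D : category) (F G : functor C D) (eta : ob C -> mor D).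
Hypothesis dom_eta : forall x, dom (eta x) = fob F x.
Hypothesis cod_eta : forall x, cod (eta x) = fob G x.
Hypothesis eta_natural : forall f,
  cmp (fmor G f) (eta (dom f)) = cmp (eta (cod f)) (fmor F f).
Implicit Types (x : ob C) (s : seq (mor C)) (p : ob C * seq (mor C)).

(** The [j]-th simplex in the standard triangulation of a prism: the path follows [F] for [j]
    arrows, crosses along [eta], then follows [G]. For [j] beyond the length the crossing comes
    last. *)
Fixpoint prism_seq j x s : seq (mor D) :=
  match j, s with
  | j'.+1, f :: s' => fmor F f :: prism_seq j' (cod f) s'
  | _, _ => eta x :: map (fmor G) s
  end.

Definition prism j p : ob D * seq (mor D) := (fob F p.1, prism_seq j p.1 p.2).

Lemma size_prism_seq j x s : size (prism_seq j x s) = (size s).+1.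
Proof. by elim: j x s => [|j IH] x [|f s] //=; rewrite ?size_map ?IH. Qed.

Lemma composable_prism j p : composable p.1 p.2 ->
  composable (prism j p).1 (prism j p).2.
Proof.
case: p => x s /=; elim: j x s => [|j IH] x [|f s] /=;
  rewrite ?dom_eta ?cod_eta ?dom_fmor ?eqxx //=.
- case/andP=> /eqP -> cs; rewrite eqxx /= cod_fmor.
  exact: (@composable_fsymb _ _ G (cod f, s)).
- by case/andP=> /eqP -> cs; rewrite eqxx cod_fmor IH.
Qed.

Lemma has_id_prism_seq j x s :
  has (@is_id C) s -> has (@is_id D) (prism_seq j x s).
Proof.
have idG r : has (@is_id C) r -> has (@is_id D) (map (fmor G) r).
  by rewrite has_map; apply: sub_has => f; exact: fmor_is_id.
elim: j x s => [|j IH] x [|f s] //= /orP[] hid.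
- by rewrite fmor_is_id ?orbT.
- by rewrite idG // !orbT.
- by rewrite fmor_is_id.
- by rewrite IH ?orbT.
Qed.

Lemma face0_prism0 p : face 0 (prism 0 p) = fsymb G p.
Proof. by case: p => x [|f s]; rewrite /face /prism /= cod_eta. Qed.

Lemma face_last_prism p :
  face (size p.2).+1 (prism (size p.2) p) = fsymb F p.
Proof.
case: p => x s; congr pair => /=; elim: s x => //= f s IH x.
by rewrite IH.
Qed.

Lemma merge_at_prism_lt i j x s : composable x s -> (i < j)%N -> (j < size s)%N ->
  merge_at i (prism_seq j.+1 x s) = prism_seq j x (merge_at i s).
Proof.
elim: i j x s => [|i IH] [|j] x [|f s] //=.
  case: s => [|g s] //= /and3P[_ /eqP gf _] _ _.
  by rewrite fmor_cmp // cod_cmp.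
by case/andP=> _ cs; rewrite !ltnS => ij js; rewrite -IH.
Qed.

(** Such a face only touches arrows on the [F] side, so the crossing moves one place back. *)
Lemma face_prism_lt i j p : composable p.1 p.2 -> (i <= j)%N -> (j < size p.2)%N ->
  face i (prism j.+1 p) = prism j (face i p).
Proof.
case: p => x s cs; case: i => [|i] le_ij lt_js.
  by case: s cs lt_js => [|f s] //= _ _; rewrite /face /prism /= cod_fmor.
by rewrite /face /prism /= merge_at_prism_lt.
Qed.

(** The common face of two neighbouring prism simplices: one composes [F f] with [eta], the other
    [eta] with [G f], and naturality identifies the results. *)
Lemma face_prism_diag j p : composable p.1 p.2 -> (j < size p.2)%N ->
  face j.+1 (prism j.+1 p) = face j.+1 (prism j p).
Proof.
case: p => x s /= cs lt_js; congr pair.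
elim: j x s cs lt_js => [|j IH] x [|f s] //= /andP[/eqP fx cs] lt_js.
  by rewrite -fx; case: s {cs lt_js} => [|g s]; rewrite /= -eta_natural.
by rewrite -IH.
Qed.

(** Here only the [G] side is touched; the index shifts by one because [eta] occupies a place before
    it. *)
Lemma face_prism_gt i j p : composable p.1 p.2 -> (j < i)%N -> (i <= size p.2)%N ->
  face i.+1 (prism j p) = prism j (face i p).
Proof.
case: p i => x s [|i] //= cs; rewrite ltnS => le_ji lt_is; congr pair => /=.
elim: j i x s cs le_ji lt_is => [|j IH] i x s cs.
  by move=> _ _ /=; rewrite (map_merge_at G i cs); case: s {cs}.
case: i s cs => [|i] [|f s] //= /andP[_ cs]; rewrite !ltnS => le_ji lt_is.
by rewrite -IH.
Qed.

(** * The prism operator and its homotopy identity *)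

Section PrismOperator.
Variable K : comPzRingType.

Definition alt_prisms n p : nchain K D n.+1 :=
  \sum_(j < n.+1) (-1) ^+ j *: symb K n.+1 (prism j p).

Definition prism_map n : nchain K C n -> nchain K D n.+1 :=
  flift (fun t : simplex C n => alt_prisms n (\val t)).

HB.instance Definition _ n := GRing.Linear.on (@prism_map n).

Lemma prism_map_symb n p : size p.2 = n -> composable p.1 p.2 ->
  prism_map (symb K n p) = alt_prisms n p.
Proof.
move=> sp cp; have [hid|nid] := boolP (has (@is_id C) p.2).
  rewrite symb_id // linear0 /alt_prisms big1 // => j _.
  by rewrite symb_id ?scaler0 // has_id_prism_seq.
have [t <-] := symb_simplex sp cp nid.
by rewrite symb_val [LHS]flift_basis.
Qed.

Lemma bd_alt_prisms n p : size p.2 = n -> composable p.1 p.2 ->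
  bd (alt_prisms n p) = \sum_(j < n.+1) \sum_(i < n.+2)
    ((-1) ^+ j * (-1) ^+ i) *: symb K n (face i (prism j p)).
Proof.
move=> sp cp; rewrite linear_sum; apply: eq_bigr => j _.
rewrite linearZ /= bd_symb ?composable_prism ?size_prism_seq ?sp //.
by rewrite /alt_faces scaler_sumr; apply: eq_bigr => i _; rewrite scalerA.
Qed.

Lemma bd_prism0 (x : nchain K C 0) :
  bd (prism_map x) = nerve_map G x - nerve_map F x.
Proof.
apply: (@fbasis_ext _ _ _ (@bd K D 0 \o @prism_map 0)
  (@nerve_map K _ _ G 0 \- @nerve_map K _ _ F 0)) => t {x} /=.
case/and3P: (valP t) => /eqP sp cp _.
rewrite [X in bd X]flift_basis bd_alt_prisms // !big_ord_recl !big_ord0 /=.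
rewrite /nerve_map !flift_basis !addr0 expr0 !mul1r expr1 scale1r scaleN1r.
by rewrite -face0_prism0 -face_last_prism sp.
Qed.

Lemma bd_prismS n (x : nchain K C n.+1) :
  bd (prism_map x) = nerve_map G x - nerve_map F x - prism_map (bd x).
Proof.
apply: (@fbasis_ext _ _ _ (@bd K D n.+1 \o @prism_map n.+1)
  (@nerve_map K _ _ G n.+1 \- @nerve_map K _ _ F n.+1
   \- (@prism_map n \o @bd K C n))) => t {x} /=.
case/and3P: (valP t) => /eqP sp cp _.
rewrite [X in bd X]flift_basis [X in prism_map X]flift_basis bd_alt_prisms //.
(* Moved to the left-hand side, the prism of the boundary becomes the second double sum of
   [alt_sum_prism]. *)
rewrite /nerve_map !flift_basis; apply/eqP; rewrite -subr_eq opprK; apply/eqP.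
have -> : prism_map (alt_faces K n (\val t)) =
    \sum_(i < n.+2) \sum_(j < n.+1) ((-1) ^+ i * (-1) ^+ j) *:
      symb K n.+1 (prism j (face i (\val t))).
  rewrite linear_sum; apply: eq_bigr => i _; rewrite linearZ /=.
  rewrite prism_map_symb ?composable_face ?size_face ?sp -1?ltnS //.
  by rewrite /alt_prisms scaler_sumr; apply: eq_bigr => j _; rewrite scalerA.
rewrite (@alt_sum_prism _ _ n.+1
  (fun i j => symb K n.+1 (face i (prism j (\val t))))
  (fun i j => symb K n.+1 (prism j (face i (\val t))))).
(* The two surviving faces are the ends of the prism, the images under [G] and [F]. *)
- by rewrite face0_prism0 -face_last_prism sp.
- by move=> i j le_ij lt_j; rewrite face_prism_lt ?sp.
- by move=> i j lt_ji le_i; rewrite face_prism_gt ?sp.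
- by move=> j lt_j; rewrite face_prism_diag ?sp.
Qed.

End PrismOperator.

End Prism.

(** * Restriction to the complexes of marked categories *)

Section OmegaPrism.
Variables (K : comPzRingType) (C D : marked_category) (F G : marked_functor C D).
Variable eta : ob C -> mor D.
Hypothesis dom_eta : forall x, dom (eta x) = fob F x.
Hypothesis cod_eta : forall x, cod (eta x) = fob G x.
Hypothesis eta_natural : forall f,
  cmp (fmor G f) (eta (dom f)) = cmp (eta (cod f)) (fmor F f).
Hypothesis eta_marked : forall x, marked (eta x).

Local Notation prism_op := (prism_map F G eta).

Lemma prism_seq_marked j x s :
  all (@marked C) s -> all (@marked D) (prism_seq F G eta j x s).
Proof.
elim: j x s => [|j IH] x [|f s] //=; rewrite ?eta_marked //=;
  case/andP=> mf ms; rewrite mfunctor_marked //= ?IH //.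
by rewrite all_map; apply: sub_all ms => g; exact: mfunctor_marked.
Qed.

Lemma prism_map_marked n (x : nchain K C n) :
  x \in @marked_chains K C n -> prism_op x \in @marked_chains K D n.+1.
Proof.
move/allP=> mx; rewrite /prism_map /flift big_seq; apply: rpred_sum => t /mx mt.
apply/rpredZ/rpred_sum => j _; apply/rpredZ/symb_marked.
exact: prism_seq_marked.
Qed.

Fact omega_prism_subproof n (x : omega_chain K C n) :
  prism_op (omega_val x) \in @omega_pred K D n.+1.
Proof.
apply/andP; split; first exact/prism_map_marked/omega_marked.
have mx := omega_marked x.
case: n x mx => [|n] x mx; first by rewrite bd_prism0 // rpredB ?nerve_map_marked.
(* The term [prism_op (bd x)] is marked because membership of [x] in the subcomplex makes [bd x]
   marked. *)
rewrite bd_prismS // !rpredB ?nerve_map_marked // prism_map_marked //.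
by case/andP: (omega_valP x).
Qed.

Definition omega_prism n (x : omega_chain K C n) : omega_chain K D n.+1 :=
  OmegaChain (omega_prism_subproof x).

Fact omega_prism_linear n : linear (@omega_prism n).
Proof. by move=> c x y; apply: val_inj; rewrite /= linearP. Qed.

HB.instance Definition _ n :=
  GRing.isLinear.Build K (omega_chain K C n) (omega_chain K D n.+1) _
    (@omega_prism n) (@omega_prism_linear n).

Lemma omega_map_homotopic : chain_homotopic (omega_map K F) (omega_map K G).
Proof.
exists (fun n => @omega_prism n : {linear omega K C n -> omega K D n.+1}).
split=> [|n] x; apply: val_inj; rewrite /= ?bd_prism0 //.
by rewrite bd_prismS // subrK.
Qed.

End OmegaPrism.

(** * Homotopies of quivers *)

Lemma one_step_homotopic (K : comPzRingType) (Q Q' : quiver) (f g : ndhom Q Q') :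
  one_step_ndhomotopic f g ->
  chain_homotopic (omega_sc_map K f) (omega_sc_map K g).
Proof.
case=> H [<- <-] {f g}.
have boxP v : degenerate (dgn v, None : arr q1).2
    || degenerate (dgn v : arr Q, None : arr q1).1.
  by rewrite degenerate_dgn orbT.
pose e v : arr (box Q q1) := exist _ (dgn v, None) (boxP v).
(* [e v] is non-degenerate since its second component [None] is, and [H] preserves this. *)
have e_nd v : degenerate (hom1 H (e v)) = false.
  by apply/negbTE/ndhomP/negP => /eqP/(congr1 \val).
have dom_e v : sq_dom (inl (hom1 H (e v))) = hom0 H (v, false).
  by rewrite /= hom_tl /= /box_tl /= dgnKt.
have cod_e v : sq_cod (inl (hom1 H (e v))) = hom0 H (v, true).
  by rewrite /= hom_hd /= /box_hd /= dgnKh.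
pose F b := sq_marked_functor (ndcomp H (inc Q b)).
apply: (@omega_map_homotopic K _ _ (F false) (F true) (fun v => inl (hom1 H (e v))))
  => // m.
have dom_F b : sq_dom (fmor (F b) m) = hom0 H (sq_dom m, b) by exact: (dom_fmor (F b) m).
have cod_F b : sq_cod (fmor (F b) m) = hom0 H (sq_cod m, b) by exact: (cod_fmor (F b) m).
rewrite [LHS]/= [RHS]/= /sq_cmp !sq_is_id_degenerate !e_nd !sq_is_id_fmor.
(* If [m] is an identity, both composites are the component at its vertex; otherwise both are the
   formal arrow between the same endpoints. *)
by case: ifP => [/sq_id_cod ->|_] //; rewrite dom_e cod_e -dom_F -cod_F.
Qed.

Theorem proposition13p11 (K : comPzRingType) (Q Q' : quiver) (f g : ndhom Q Q') :
  ndhomotopic f g ->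
  chain_homotopic (omega_sc_map K f) (omega_sc_map K g).
Proof.
elim=> {f g} [f g|f|f g _|f g k _ fg _ gk].
- exact: one_step_homotopic.
- exact: chain_homotopic_refl.
- exact: chain_homotopic_sym.
- exact: chain_homotopic_trans fg gk.
Qed.
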